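(* Let $X$ be a $d$-dimensional Lévy basket with an associated family of risk-neutral measures $(\mathbb{P}^x)_{x\in\mathbb{R}^d}$ and discount rate $r>0$. Let $G=\gamma+H$ for some $\gamma\in\mathbb{R}^d$ and some measurable set $H\subseteq\mathbb{R}^d$ such that $0\notin H$ and such that both $H$ and $\complement H$ are $+$-closed. Then for all $s>0$ (whenever $\rho(s)(\gamma)$ is well-defined, in which case the limits as $t\downarrow 0$ below exist) \begin{align*} \rho(s)(\gamma)&=\left.\sum_{n=1}^\infty e^{-rnt}\,\mathbb{P}^{\gamma}\left[\bigcap_{i=1}^{n-1}\{X_{it}\in\complement G\}\cap\{X_{nt}\in G\}\right]\right|^{t\downarrow 0}_{t=s}\\ &=\left.\sum_{n=1}^\infty e^{-rnt}\,\mathbb{P}^{0}\left[\bigcap_{i=1}^{n-1}\{X_{it}\in\complement H\}\cap\{X_{nt}\in H\}\right]\right|^{t\downarrow 0}_{t=s}\\ &=\left.\exp\left(-\sum_{n=1}^\infty\frac{e^{-rnt}}{n}\,\mathbb{P}^{0}\{X_{nt}\in G-\gamma\}\right)\right|^{t=s}_{t\downarrow 0}. \end{align*}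
   Context: Lévy basket: $X=(X_t)_{t\ge 0}$ is an $\mathbb{R}^d$-valued càdlàg process adapted to a filtration $(\mathcal{F}_t)_{t\ge0}$, together with probability measures $(\mathbb{P}^x)_{x\in\mathbb{R}^d}$ (the risk-neutral measures; expectation $\mathbb{E}^x$) and a constant $r>0$ (the discount rate), such that for every $x$, under $\mathbb{P}^x$, $X$ starts at $x$ and is a homogeneous Markov process with respect to $(\mathcal{F}_t)$ whose transition function (not depending on $x$) is a translation-invariant Feller semigroup (so $X$ is a Lévy process started at $x$), and such that for some constants $\delta_1,\dots,\delta_d\ge0$ (dividend yields) each process $\exp((X_t)_i-(r-\delta_i)t)$, $i=1,\dots,d$, is a $\mathbb{P}^x$-martingale. A set $A\subseteq\mathbb{R}^d$ is $+$-closed if it is measurable and $A+A\subseteq A$. $\complement A=\mathbb{R}^d\setminus A$. $\mathbb{N}=\{1,2,\dots\}$. For $t>0$, $\tau_G^{t\mathbb{N}}:=\min\{u\in t\mathbb{N}: X_u\in G\}$ ($=+\infty$ if there is no such $u$, with $e^{-r\cdot\infty}=0$), and $$\rho(s)(x):=\lim_{t\downarrow0}\mathbb{E}^x\left[e^{-r\tau_G^{t\mathbb{N}}}-e^{-r\tau_G^{s\mathbb{N}}}\right]$$ whenever this limit exists (''$\rho(s)(x)$ is well-defined''). Notation: $\left.F(t)\right|^{t\downarrow0}_{t=s}:=\lim_{t\downarrow0}F(t)-F(s)$ and $\left.F(t)\right|^{t=s}_{t\downarrow0}:=F(s)-\lim_{t\downarrow0}F(t)$. *)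

(* Defs.v *)
From HB Require Import structures.
From mathcomp Require Import all_boot all_order all_algebra.
From mathcomp Require Import all_classical all_reals all_analysis.

Set Implicit Arguments.
Unset Strict Implicit.
Unset Printing Implicit Defensive.
Import Order.TTheory GRing.Theory Num.Theory.
Import numFieldNormedType.Exports.

Local Open Scope classical_set_scope.
Local Open Scope ring_scope.

(* The space R^d, i.e. 'rV[R]_d, with its Borel sigma-algebra. *)
Notation borelRV R d := (g_sigma_algebraType (@open 'rV[R]_d)).

Definition borel_set (R : realType) (d : nat) (A : set 'rV[R]_d) : Prop :=
  measurable (A : set (borelRV R d)).

Definition plus_closed (R : realType) (d : nat) (A : set 'rV[R]_d) : Prop :=
  borel_set A /\ [set x + y | x in A & y in A] `<=` A.

(* Z is a version of the conditional expectation of Y given the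
   sub-sigma-algebra G. *)
Definition is_cond_expectation (R : realType) (disp : measure_display)
    (T : measurableType disp) (P : probability T R) (G : set (set T))
    (Y Z : T -> R) : Prop :=
  [/\ forall B : set R, measurable B -> G (Z @^-1` B),
      P.-integrable setT (EFin \o Z) &
      forall A, G A ->
        (\int[P]_(w in A) (Z w)%:E)%E = (\int[P]_(w in A) (Y w)%:E)%E].

(* Time runs over [0, +oo[; indices are reals, and the values at negative
   indices are irrelevant here and in all the definitions that follow. *)
Definition is_filtration (R : realType) (disp : measure_display)
    (T : measurableType disp) (F : R -> set (set T)) : Prop :=
  [/\ forall t, 0 <= t -> sigma_algebra setT (F t),
      forall t, 0 <= t -> F t `<=` measurable &
      forall s t, 0 <= s -> s <= t -> F s `<=` F t].

Definition is_martingale (R : realType) (disp : measure_display)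
    (T : measurableType disp) (F : R -> set (set T)) (P : probability T R)
    (M : R -> T -> R) : Prop :=
  [/\ forall t, 0 <= t ->
        forall B : set R, measurable B -> F t (M t @^-1` B),
      forall t, 0 <= t -> P.-integrable setT (EFin \o M t) &
      forall s t, 0 <= s -> s <= t -> is_cond_expectation P (F s) (M t) (M s)].

Definition is_adapted (R : realType) (d : nat) (disp : measure_display)
    (T : measurableType disp) (F : R -> set (set T))
    (X : R -> T -> 'rV[R]_d) : Prop :=
  forall t, 0 <= t -> forall B, borel_set B -> F t (X t @^-1` B).

Definition is_cadlag (R : realType) (d : nat) (x : R -> 'rV[R]_d) : Prop :=
  (forall t, 0 <= t -> x u @[u --> t^'+] --> x t) /\
  (forall t, 0 < t -> cvg (x u @[u --> t^'-])).

Definition is_markov (R : realType) (d : nat) (disp : measure_display)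
    (T : measurableType disp) (F : R -> set (set T)) (P : probability T R)
    (p : R -> R.-pker borelRV R d ~> borelRV R d)
    (X : R -> T -> 'rV[R]_d) : Prop :=
  forall s t, 0 <= s -> 0 <= t -> forall B, borel_set B ->
    is_cond_expectation P (F s)
      (\1_(X (s + t) @^-1` B)) (fun w => fine (p t (X s w) B)).

(* C_0(R^d) *)
Definition vanishing_continuous (R : realType) (d : nat)
    (f : 'rV[R]_d -> R) : Prop :=
  continuous f /\
  forall e, 0 < e -> exists2 K, compact K & forall x, ~ K x -> `|f x| < e.

Definition transition_op (R : realType) (d : nat)
    (p : R -> R.-pker borelRV R d ~> borelRV R d) (t : R)
    (f : 'rV[R]_d -> R) (x : 'rV[R]_d) : R :=
  \int[p t x]_y f y.

(* The transition function p is a semigroup (Chapman-Kolmogorov), maps C_0 to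
   itself and is strongly continuous on C_0 for the supremum norm. *)
Definition is_feller_semigroup (R : realType) (d : nat)
    (p : R -> R.-pker borelRV R d ~> borelRV R d) : Prop :=
  [/\ forall x (B : set 'rV[R]_d), borel_set B -> p 0 x B = \d_x B,
      forall s t, 0 <= s -> 0 <= t ->
        forall x (B : set 'rV[R]_d), borel_set B ->
          p (s + t) x B = (\int[p s x]_y p t y B)%E,
      forall t, 0 <= t -> forall f, vanishing_continuous f ->
        vanishing_continuous (transition_op p t f) &
      forall f, vanishing_continuous f -> forall e, 0 < e ->
        \forall t \near 0^'+, forall x, `|transition_op p t f x - f x| < e].

Definition translation_invariant (R : realType) (d : nat)
    (p : R -> R.-pker borelRV R d ~> borelRV R d) : Prop :=
  forall t, 0 <= t -> forall x z (B : set 'rV[R]_d), borel_set B ->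
    p t (x + z) [set y + z | y in B] = p t x B.

Definition is_levy_basket (R : realType) (d : nat) (disp : measure_display)
    (T : measurableType disp) (F : R -> set (set T)) (X : R -> T -> 'rV[R]_d)
    (P : 'rV[R]_d -> probability T R) (r : R) : Prop :=
  [/\ is_filtration F, is_adapted F X, forall w, is_cadlag (X ^~ w), 0 < r &
  [/\ forall x, P x (X 0 @^-1` [set x]) = 1%E,
      exists p : R -> R.-pker borelRV R d ~> borelRV R d,
        [/\ is_feller_semigroup p, translation_invariant p &
            forall x, is_markov F (P x) p X] &
      exists2 delta : 'I_d -> R, (forall i, 0 <= delta i) &
        forall x i, is_martingale F (P x)
          (fun t w => expR (X t w ord0 i - (r - delta i) * t))]].

(* tau_G^{tN} = min {u in tN | X_u in G}, with N = {1, 2, ...}, and +oo if this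
   set is empty. *)
Definition hits_at (R : realType) (d : nat) (T : Type)
    (X : R -> T -> 'rV[R]_d) (G : set 'rV[R]_d) (t : R) (w : T) (n : nat) :
    bool :=
  (0 < n)%N && `[< G (X (n%:R * t) w) >].

Definition hitting_time (R : realType) (d : nat) (T : Type)
    (X : R -> T -> 'rV[R]_d) (G : set 'rV[R]_d) (t : R) (w : T) : \bar R :=
  match pselect (exists n, hits_at X G t w n) with
  | left h => ((ex_minn h)%:R * t)%:E
  | right _ => +oo%E
  end.

(* exp(- r u); for r > 0 it is 0 at u = +oo, because expeR -oo = 0. *)
Definition discount (R : realType) (r : R) (u : \bar R) : R :=
  fine (expeR (- (r%:E * u))).

(* E^x [exp(- r tau_G^{tN}) - exp(- r tau_G^{sN})], whose limit as t tends to
   0+ is rho(s)(x). *)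
Definition discount_gap (R : realType) (d : nat) (disp : measure_display)
    (T : measurableType disp) (X : R -> T -> 'rV[R]_d)
    (P : 'rV[R]_d -> probability T R) (r : R) (G : set 'rV[R]_d)
    (s : R) (x : 'rV[R]_d) (t : R) : R :=
  fine 'E_(P x)[(fun w => discount r (hitting_time X G t w)
                         - discount r (hitting_time X G s w))%R]%E.

Definition rho_defined (R : realType) (d : nat) (disp : measure_display)
    (T : measurableType disp) (X : R -> T -> 'rV[R]_d)
    (P : 'rV[R]_d -> probability T R) (r : R) (G : set 'rV[R]_d)
    (s : R) (x : 'rV[R]_d) : Prop :=
  cvg (discount_gap X P r G s x t @[t --> 0^'+]).

Definition rho (R : realType) (d : nat) (disp : measure_display)
    (T : measurableType disp) (X : R -> T -> 'rV[R]_d)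
    (P : 'rV[R]_d -> probability T R) (r : R) (G : set 'rV[R]_d)
    (s : R) (x : 'rV[R]_d) : R :=
  lim (discount_gap X P r G s x t @[t --> 0^'+]).

(* The brackets f(t)|_{t=s}^{t->0+} and, below, f(t)|_{t->0+}^{t=s}. *)
Definition eval_s_to_0 (R : realType) (f : R -> R) (s : R) : R :=
  lim (f t @[t --> 0^'+]) - f s.

Definition eval_0_to_s (R : realType) (f : R -> R) (s : R) : R :=
  f s - lim (f t @[t --> 0^'+]).

Definition first_entry (R : realType) (d : nat) (T : Type)
    (X : R -> T -> 'rV[R]_d) (G : set 'rV[R]_d) (t : R) (n : nat) : set T :=
  \bigcap_(i in [set i : nat | (1 <= i <= n.-1)%N])
     (X (i%:R * t) @^-1` (~` G))
  `&` (X (n%:R * t) @^-1` G).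

Definition first_entry_series (R : realType) (d : nat)
    (disp : measure_display) (T : measurableType disp)
    (X : R -> T -> 'rV[R]_d) (r : R) (Q : probability T R)
    (G : set 'rV[R]_d) (t : R) : R :=
  fine (\sum_(1 <= n <oo)
          (expR (- (r * n%:R * t))%R)%:E * Q (first_entry X G t n))%E.

Definition entry_exp_series (R : realType) (d : nat)
    (disp : measure_display) (T : measurableType disp)
    (X : R -> T -> 'rV[R]_d) (r : R) (Q : probability T R)
    (G : set 'rV[R]_d) (t : R) : R :=
  expR (- fine (\sum_(1 <= n <oo)
          (expR (- (r * n%:R * t)) / n%:R)%R%:E
          * Q (X (n%:R * t)%R @^-1` G))%E).

(* Main.v *)
From HB Require Import structures.
Require Import Defs.
From mathcomp Require Import all_boot all_order all_algebra.
From mathcomp Require Import all_classical all_reals all_analysis.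
From mathcomp Require Import measurable_realfun zify ring lra.

Import Order.TTheory GRing.Theory Num.Theory.
Import numFieldNormedType.Exports.

Local Open Scope classical_set_scope.
Local Open Scope ring_scope.

(** Fix a step [t > 0] and put [z = exp(- r t)].  On the grid of multiples of
    [t], the process [Y n = X (n t) - x] is under [P x] a random walk started
    at [0], whose increments have a law [mu] that does not depend on [x]
    ([centred_walkP]); hitting [x + H] means for [Y] to enter [H].  With
    [f n] the probability that [Y] enters [H] for the first time at [n], the
    expected discount factor is the sum of the [z ^ n * f n]
    ([integral_discount]), and the expectation that defines rho is a difference
    of two such sums ([discount_gapE]).  So everything follows, for each [t]
    separately, from
      [1 - sum_n z ^ n * f n = exp (- sum_n z ^ n / n * a n)]
    with [a n = P (Y n in H)] ([spitzer_identity]): the right-hand side depends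
    on [mu] and [H] only, hence not on the starting point ([walk_law]), and the
    three limits at [0+] exist as soon as one of them does.

    The identity is a Wiener-Hopf factorisation.  In the convolution algebra of
    measures, [delta_0 - z mu] is the exponential of minus the sum of the
    [z ^ n mu^n / n].  Cutting each [mu^n] into its restrictions to [H] and to
    the complement of [H] splits this exponential in two.  Since both sets are
    closed under addition, one factor is [delta_0] minus a measure on [H] and
    the other is the inverse of [delta_0] plus a measure on the complement, and
    such a factorisation is unique: the two measures generate the laws of [Y]
    at its first entrance in [H] and of [Y] killed at that entrance.  Taking
    total masses of the first factor gives the identity.

    The proof below extracts coefficients instead of manipulating power series
    with measure coefficients.  After a logarithmic derivative in [z], the
    factorisation becomes two coupled recursions, which are proved together by
    induction ([abstract_surv_recursion] and [abstract_enter_recursion]); the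
    total mass of the second one reads
      [n * f n + sum_(1 <= k < n) f k * a (n - k) = a n]
    ([entrance_recursion]).  The only analytic input is that averaging
    operators over independent shifts commute, by Fubini ([shift_avgC]).  The
    recursion says that [phi = 1 - sum_n f n x ^ n] and
    [psi = sum_n a n x ^ n / n] satisfy [phi' + phi psi' = 0], so that
    [phi exp psi] keeps its value [1] at [x = 0]; this is carried out on
    truncated series, where the defect is a polynomial divisible by a high
    power of [x] ([entrance_partial_sums]). *)

Set Implicit Arguments.
Unset Strict Implicit.
Unset Printing Implicit Defensive.

(** * Measurability of vector addition *)

Section BorelAddition.
Context (R : realType) (d : nat).
Local Notation V := 'rV[R]_d.
Local Notation borelV := (borelRV R d).

Lemma measurable_open_rV (U : set V) : open U -> borel_set U.
Proof. by move=> oU; apply: sub_sigma_algebra. Qed.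

Lemma rat_rV_approx (x : V) (e : R) : 0 < e ->
  exists q : 'rV[rat]_d, ball (map_mx ratr q : V) e x.
Proof.
move=> e0.
have approx (y : R) : exists q : rat, `|ratr q - y| < e.
  have /rat_in_itvoo[q] : y < y + e by rewrite ltrDl.
  rewrite in_itv/= => /andP[yq qe]; exists q.
  by rewrite gtr0_norm ?subr_gt0// ltrBlDl.
have /choice[f fP] : forall j, exists q : rat, `|ratr q - x ord0 j| < e.
  by move=> j; exact: approx.
exists (\row_j f j); split=> // i j.
by rewrite !mxE /ball/= (ord1 i); exact: fP.
Qed.

(** The sigma-algebra of the domain is the product of the Borel
    sigma-algebras, which contains the open sets of the product only because
    the space has a countable base: the preimage of an open set is a countable
    union of products of balls with rational centres and radii. *)
Lemma measurable_addV :
  measurable_fun [set: borelV * borelV] (fun z => (z.1 : V) + (z.2 : V) : borelV).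
Proof.
apply: (measurability (@open V : set (set borelV))); first by [].
move=> _ [U oU <-]; rewrite setTI.
(* the rational pairs of balls with the same radius whose sum lies in [U] *)
pose good (k : 'rV[rat]_d * 'rV[rat]_d * rat) : set (borelV * borelV) :=
  if pselect (ball (map_mx ratr k.1.1 : V) (ratr k.2) `*`
     ball (map_mx ratr k.1.2 : V) (ratr k.2) `<=` (fun z => U (z.1 + z.2)))
  then ball (map_mx ratr k.1.1 : V) (ratr k.2) `*`
     ball (map_mx ratr k.1.2 : V) (ratr k.2) else set0.
rewrite [X in measurable X](_ : _ = \bigcup_k good k); last first.
  apply/seteqP; split=> [[x y]/= Uxy|[x y] [k _]]; last first.
    by rewrite /good; case: pselect => // kU; exact: kU.
  have /nbhs_ballP[e /= e0 eU] := open_nbhs_nbhs (conj oU Uxy).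
  have /rat_in_itvoo[q] : (0 : R) < e / 4 by rewrite divr_gt0.
  rewrite in_itv/= => /andP[q0 qe].
  have [a xa] := rat_rV_approx x q0.
  have [b yb] := rat_rV_approx y q0.
  exists (a, b, q) => //; rewrite /good; case: pselect => //= nU.
  exfalso; apply: nU => -[x' y'] /= [[_ xa'] [_ yb']].
  case: xa yb => [_ xa] [_ yb].
  apply: eU; split=> // i j; rewrite !mxE.
  move: (xa i j) (yb i j) (xa' i j) (yb' i j); rewrite /ball/= !mxE.
  rewrite !ltr_norml => /andP[h1 h2] /andP[h3 h4] /andP[h5 h6] /andP[h7 h8].
  by apply/andP; split; lra.
apply: countable_bigcupT_measurable => // -[[a b] q].
rewrite /good; case: pselect => //= _.
by apply: measurableX; apply: measurable_open_rV; exact: ball_open.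
Qed.
End BorelAddition.

(** * Averaging over independent shifts *)

Section Averaging.
Local Open Scope ereal_scope.
Context (R : realType) (d : nat).
Local Notation V := 'rV[R]_d.
Local Notation borelV := (borelRV R d).
Local Notation "x +v y" := ((x : V) + (y : V) : borelV)%R (at level 50).

Lemma ge0_integral_mrestr dS (S : measurableType dS)
    (m : {measure set S -> \bar R}) (D : set S) (mD : measurable D)
    (f : S -> \bar R) :
  measurable_fun setT f -> (forall x, 0 <= f x) ->
  \int[mrestr m mD]_x f x = \int[m]_(x in D) f x.
Proof.
move=> mf f0.
rewrite (@ge0_negligible_integral _ _ _ (mrestr m mD) setT (~` D))//.
- rewrite setTD setCK; apply: eq_measure_integral => A mA AD.
  by rewrite /= /mrestr setIidl.
- exact: measurableC.
- by rewrite /= /mrestr setICl measure0.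
Qed.

(** Convolution with the law of [Z] under [m], acting on functions.  Allowing an
    arbitrary [S] and [Z] covers both the increment law of a walk and the
    position of a walk on the event that it lies in a given set. *)
Definition shift_avg dS (S : measurableType dS)
    (m : {measure set S -> \bar R}) (Z : S -> borelV)
    (g : borelV -> \bar R) (x : borelV) : \bar R :=
  \int[m]_w g (x +v Z w).

(** Values in [[0, 1]] keep every integral below finite, so that identities
    between extended reals can be rearranged as identities between reals. *)
Definition test_fun (g : borelV -> \bar R) : Prop :=
  measurable_fun setT g /\ forall x, 0 <= g x <= 1.

Lemma test_fun_ge0 g x : test_fun g -> 0 <= g x.
Proof. by move=> [_ /(_ x)/andP[]]. Qed.

Lemma test_fun_le1 g x : test_fun g -> g x <= 1.
Proof. by move=> [_ /(_ x)/andP[]]. Qed.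

Lemma measurable_fun_addV dS (S : measurableType dS) (Z1 Z2 : S -> borelV) :
  measurable_fun setT Z1 -> measurable_fun setT Z2 ->
  measurable_fun setT (fun w => Z1 w +v Z2 w).
Proof.
move=> mZ1 mZ2.
exact: (measurableT_comp (@measurable_addV R d) (measurable_fun_pair mZ1 mZ2)).
Qed.

Section ShiftAvg.
Context dS (S : measurableType dS) (m : {finite_measure set S -> \bar R}).
Variables (Z : S -> borelV) (g : borelV -> \bar R).
Hypothesis mZ : measurable_fun setT Z.

Lemma measurable_shift_avg : measurable_fun setT g -> (forall x, 0 <= g x) ->
  measurable_fun setT (shift_avg m Z g).
Proof.
move=> mg g0.
apply: (@measurable_fun_fubini_tonelli_F _ _ borelV S R m
  (fun z => g (z.1 +v Z z.2))) => //.
apply: (measurableT_comp mg); apply: measurable_fun_addV => //.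
exact: measurableT_comp.
Qed.

Lemma test_shift_avg : m setT <= 1 -> test_fun g -> test_fun (shift_avg m Z g).
Proof.
move=> m1 tg; split=> [|x].
  by apply: measurable_shift_avg; [case: tg|move=> y; exact: test_fun_ge0].
apply/andP; split.
  by apply: integral_ge0 => w _; exact: test_fun_ge0.
apply: (le_trans _ m1); rewrite -[leRHS]mul1e -integral_cst//.
apply: ge0_le_integral => //.
- by move=> w _; exact: test_fun_ge0.
- case: tg => mg _; apply: (measurableT_comp mg).
  exact: measurable_fun_addV.
- by move=> w _; exact: test_fun_le1.
Qed.

End ShiftAvg.

(** Adding two independent shifts in either order gives the same average: this
    is where the commutativity of convolution comes from. *)
Lemma shift_avgC dS1 dS2 (S1 : measurableType dS1) (S2 : measurableType dS2)
    (m1 : {finite_measure set S1 -> \bar R})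
    (m2 : {finite_measure set S2 -> \bar R})
    (Z1 : S1 -> borelV) (Z2 : S2 -> borelV) (g : borelV -> \bar R) :
  measurable_fun setT Z1 -> measurable_fun setT Z2 ->
  measurable_fun setT g -> (forall x, 0 <= g x) ->
  shift_avg m1 Z1 (shift_avg m2 Z2 g) = shift_avg m2 Z2 (shift_avg m1 Z1 g).
Proof.
move=> mZ1 mZ2 mg g0; apply/funext => x; rewrite /shift_avg.
rewrite (@fubini_tonelli _ _ S1 S2 R m1 m2
  (fun z => g ((x +v Z1 z.1) +v Z2 z.2)))//.
  by apply: eq_integral => w2 _; apply: eq_integral => w1 _; rewrite addrAC.
apply: (measurableT_comp mg); apply: measurable_fun_addV.
- by apply: measurable_fun_addV => //; exact: measurableT_comp.
- exact: measurableT_comp.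
Qed.

End Averaging.

(** * The factorisation as a pair of recursions *)

(** The combinatorial core, freed from measure theory.  The elements of [E]
    stand for test functions.  [c n] integrates against the law of the walk at
    time [n] killed when entering [H], and [e n] against its law at the entrance
    when this happens at time [n + 1]; [U] averages over one increment, and
    [J m], [A m], [B m] over the position at time [m] of an independent copy,
    unrestricted, or restricted to [H] or to its complement.  [cutin] and
    [cutout] multiply a test function by the indicator of [H] or of its
    complement; the hypotheses on them say which of these measures live on [H]
    and which on the complement. *)
Section AbstractRecursion.
Local Open Scope ring_scope.
Context (K : comNzRingType) (E : Type) (ok : E -> Prop).
Variables (c e : nat -> E -> K) (U : E -> E) (A B J : nat -> E -> E).
Variables (cutin cutout : E -> E).
Hypothesis okU : forall g, ok g -> ok (U g).
Hypothesis okA : forall m g, ok g -> ok (A m g).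
Hypothesis ok_cutin : forall g, ok g -> ok (cutin g).
Hypothesis ok_cutout : forall g, ok g -> ok (cutout g).
Hypothesis cU : forall n g, ok g -> c n (U g) = c n.+1 g + e n g.
Hypothesis cJ : forall n m g, ok g -> c n (J m g) = c n (A m g) + c n (B m g).
Hypothesis J0 : forall g, J 0 g = g.
Hypothesis JS : forall m g, ok g -> J m.+1 g = J m (U g).
Hypothesis AU : forall m g, ok g -> A m (U g) = U (A m g).
Hypothesis c_in : forall n g, c n (cutin g) = 0.
Hypothesis c_out : forall n g, c n (cutout g) = c n g.
Hypothesis e_in : forall n g, e n (cutin g) = e n g.
Hypothesis e_out : forall n g, e n (cutout g) = 0.
Hypothesis cB_in : forall n m g, c n (B m (cutin g)) = 0.
Hypothesis cB_out : forall n m g, c n (B m (cutout g)) = c n (B m g).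
Hypothesis eA_in : forall n m g, e n (A m (cutin g)) = e n (A m g).
Hypothesis eA_out : forall n m g, e n (A m (cutout g)) = 0.
Hypothesis c0A_in : forall m g, c 0 (A m (cutin g)) = c 0 (A m g).
Hypothesis c0A_out : forall m g, c 0 (A m (cutout g)) = 0.

(** The two recursions added up, before the parts on [H] and on the complement
    are separated.  It uses the recursion for [c n] at the test function
    [U g], and the relation [cU] to express each [e k] by [c k] and
    [c k.+1], which makes the sums telescope. *)
Let joint_step n g :
  (forall g, ok g -> n%:R * c n g = \sum_(k < n) c k (B (n - k) g)) -> ok g ->
  n.+1%:R * (c n.+1 g + e n g) + \sum_(k < n) e k (A (n - k) g) =
  \sum_(k < n.+1) c k (B (n.+1 - k) g) + c 0 (A n.+1 g).
Proof.
move=> ih og; rewrite -cU// -addn1 natrD mulrDl mul1r ih; last exact: okU.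
have eA (k : 'I_n) : true -> e k (A (n - k) g) =
    c k (A (n - k) (U g)) - c k.+1 (A (n - k) g).
  move=> _; rewrite AU// cU; last exact: okA.
  by rewrite [RHS]addrAC subrr add0r.
rewrite (eq_bigr _ eA) sumrB addn1.
have tot : \sum_(k < n.+1) c k (J (n.+1 - k) g) =
    \sum_(k < n) c k (A (n - k) (U g)) +
    \sum_(k < n) c k (B (n - k) (U g)) + c n (U g).
  rewrite big_ord_recr/= subSnn -big_split/=; congr (_ + _).
    apply: eq_bigr => k _; rewrite subSn ?JS//; last exact: ltnW.
    by rewrite cJ//; exact: okU.
  by rewrite JS// J0.
have : \sum_(k < n.+1) c k (J (n.+1 - k) g) =
    c 0 (A n.+1 g) + \sum_(k < n) c k.+1 (A (n - k) g) +
    \sum_(k < n.+1) c k (B (n.+1 - k) g).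
  under eq_bigr do rewrite cJ//.
  rewrite big_split/=; congr (_ + _).
  by rewrite big_ord_recl/= subn0; congr (_ + _).
by rewrite tot => h; rewrite addrA [X in X - _]addrC addrA h; ring.
Qed.

(** Testing [joint_step] against functions supported in the complement of [H]
    kills all terms carried by [H]; this closes the induction. *)
Lemma abstract_surv_recursion n g : ok g ->
  n%:R * c n g = \sum_(k < n) c k (B (n - k) g).
Proof.
elim: n g => [|n ih] g og; first by rewrite mul0r big_ord0.
have := joint_step ih (ok_cutout og).
rewrite c_out e_out c0A_out !addr0.
rewrite [X in _ + X]big1; last by move=> k _; rewrite eA_out.
by rewrite addr0 => ->; apply: eq_bigr => k _; rewrite cB_out.
Qed.

(** The same step tested against functions supported in [H]. *)
Lemma abstract_enter_recursion n g : ok g ->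
  n.+1%:R * e n g + \sum_(k < n) e k (A (n - k) g) = c 0 (A n.+1 g).
Proof.
move=> og; have := joint_step (abstract_surv_recursion n) (ok_cutin og).
rewrite c_in e_in c0A_in add0r.
rewrite [X in _ = X + _ -> _]big1 ?add0r; last by move=> k _; rewrite cB_in.
by move=> <-; congr (_ + _); apply: eq_bigr => k _; rewrite eA_in.
Qed.

End AbstractRecursion.

(** * Random walks and their first entrance in a set *)

Section RandomWalk.
Local Open Scope ereal_scope.
Context (R : realType) (d : nat) (disp : measure_display).
Context (T : measurableType disp).
Local Notation V := 'rV[R]_d.
Local Notation borelV := (borelRV R d).
Local Notation "x +v y" := ((x : V) + (y : V) : borelV)%R (at level 50).

(** The Markov property is asked of events only; [walk_step] extends it to
    functions. *)
Record random_walk (P : probability T R) (F : nat -> set (set T))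
    (mu : probability borelV R) (Y : nat -> T -> borelV) : Prop := RandomWalk {
  walk_start : forall w, Y 0%N w = 0%R ;
  walk_setT : forall n, F n setT ;
  walk_setI : forall n, setI_closed (F n) ;
  walk_mono : forall n, F n `<=` F n.+1 ;
  walk_measurable : forall n, F n `<=` measurable ;
  walk_adapted : forall n (B : set borelV), measurable B -> F n (Y n @^-1` B) ;
  walk_markov : forall n A (B : set borelV), F n A -> measurable B ->
    P (A `&` Y n.+1 @^-1` B) = \int[P]_(w in A) mu [set y | B (Y n w +v y)]
}.

Variables (P : probability T R) (F : nat -> set (set T)).
Variables (mu : probability borelV R) (Y : nat -> T -> borelV).
Hypothesis W : random_walk P F mu Y.

Lemma measurable_walk n : measurable_fun setT (Y n).
Proof.
by move=> _ B mB; rewrite setTI; exact: (walk_measurable W (walk_adapted W n mB)).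
Qed.
Hint Resolve measurable_walk : core.

Lemma measurable_walk_preimage n (B : set borelV) :
  measurable B -> measurable (Y n @^-1` B).
Proof. by move=> mB; rewrite -[X in measurable X]setTI; exact: measurable_walk. Qed.

Definition step (g : borelV -> \bar R) : borelV -> \bar R := shift_avg mu id g.

Lemma test_step g : test_fun g -> test_fun (step g).
Proof. by apply: test_shift_avg => //; exact: probability_le1. Qed.

(** Both sides are integrals of [g] against measures on the state space: the law
    of [Y n.+1] on [A], and the image by addition of the product of the law of
    [Y n] on [A] with [mu].  The Markov property says that they agree on Borel
    sets. *)
Lemma walk_step n A g : F n A -> measurable_fun setT g -> (forall x, 0 <= g x) ->
  \int[P]_(w in A) g (Y n.+1 w) = \int[P]_(w in A) step g (Y n w).
Proof.
move=> FA mg g0.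
have mA : measurable A := walk_measurable W FA.
pose Z (z : T * borelV) : borelV := Y n z.1 +v z.2.
have mZ : measurable_fun setT Z.
  by apply: measurable_fun_addV => //; exact: measurableT_comp.
have mgY : measurable_fun setT (fun w => g (Y n.+1 w)) by exact: measurableT_comp.
have msg : measurable_fun setT (step g) by exact: measurable_shift_avg.
have sg0 x : 0 <= step g x by exact: integral_ge0.
rewrite -[LHS](ge0_integral_mrestr P mA)// -[RHS](ge0_integral_mrestr P mA)//; last first.
  exact: measurableT_comp.
pose PA : {finite_measure set T -> \bar R} := mrestr P mA.
transitivity (\int[pushforward PA (Y n.+1)]_y g y).
  by rewrite ge0_integral_pushforward.
transitivity (\int[pushforward (PA \x mu) Z]_y g y).
  apply: eq_measure_integral => B mB _.
transitivity (P (A `&` Y n.+1 @^-1` B)); first by rewrite setIC.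
  rewrite (walk_markov W FA mB).
  transitivity (\int[mrestr P mA]_w (mu \o xsection (Z @^-1` B)) w); last by [].
  rewrite ge0_integral_mrestr//; last first.
    apply: measurable_fun_xsection; rewrite -[X in measurable X]setTI.
    exact: mZ.
  apply: eq_integral => w _ /=; congr (mu _).
  by apply/seteqP; split=> y; rewrite /xsection/= inE.
rewrite ge0_integral_pushforward// preimage_setT fubini_tonelli1//.
- exact: measurableT_comp.
- by move=> z; exact: g0.
Qed.

(** The point [x] will be the position of the walk itself at another time; a
    fresh integral over [P] makes the shift [Y m] independent of it. *)
Definition jump (D : set borelV) m (g : borelV -> \bar R) (x : borelV) :=
  \int[P]_(w in Y m @^-1` D) g (x +v Y m w).

Section jump.
Variable D : set borelV.
Hypothesis mD : measurable D.

Lemma jumpE m g : measurable_fun setT g -> (forall x, 0 <= g x) ->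
  jump D m g = shift_avg (mrestr P (measurable_walk_preimage m mD)) (Y m) g.
Proof.
move=> mg g0; apply/funext => x; rewrite /shift_avg ge0_integral_mrestr//.
by apply: (measurableT_comp mg); exact: measurable_fun_addV.
Qed.

Lemma test_jump m g : test_fun g -> test_fun (jump D m g).
Proof.
move=> tg; rewrite jumpE; [|by case: tg|by move=> x; exact: test_fun_ge0].
apply: test_shift_avg => //.
by rewrite /= /mrestr setTI probability_le1//; exact: measurable_walk_preimage.
Qed.

Lemma jump_step m g : test_fun g -> jump D m (step g) = step (jump D m g).
Proof.
move=> tg; rewrite !jumpE; last 4 first.
- by case: tg.
- by move=> x; exact: test_fun_ge0.
- by case: (test_step tg).
- by move=> x; exact: test_fun_ge0 (test_step tg).
by apply: shift_avgC => //; [case: tg|move=> x; exact: test_fun_ge0].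
Qed.

Lemma jump_id m g (D' : set borelV) x : (forall y, D y -> D' (x +v y)) ->
  jump D m (g \_ D') x = jump D m g x.
Proof.
move=> h; apply: eq_integral => w; rewrite inE/= => Dw.
by rewrite patchE mem_set//; exact: h.
Qed.

Lemma jump_eq0 m g (D' : set borelV) x : (forall y, D y -> ~ D' (x +v y)) ->
  jump D m (g \_ D') x = 0.
Proof.
move=> h; apply: integral0_eq => w /= Dw.
by rewrite patchE memNset//; exact: h.
Qed.

Lemma jumpC m g : test_fun g ->
  jump setT m g = fun x => jump D m g x + jump (~` D) m g x.
Proof.
move=> tg; apply/funext => x; rewrite /jump -ge0_integral_setU.
- by rewrite -preimage_setU setUCr.
- exact: measurable_walk_preimage.
- exact/measurable_walk_preimage/measurableC.
- apply: measurable_funTS; case: tg => mg _; apply: (measurableT_comp mg).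
  exact: measurable_fun_addV.
- by move=> w _; exact: test_fun_ge0.
- by rewrite -preimage_setC; apply/disj_set2P; rewrite setICr.
Qed.

End jump.

Lemma jumpT0 g : jump setT 0 g = g.
Proof.
apply/funext => x; rewrite /jump preimage_setT.
under eq_integral do rewrite (walk_start W) addr0.
rewrite integral_cst// -[RHS]mule1; congr (_ * _); exact: probability_setT.
Qed.

Lemma jumpTS m g : test_fun g -> jump setT m.+1 g = step (jump setT m g).
Proof.
move=> tg; rewrite -jump_step//; apply/funext => x; rewrite /jump preimage_setT.
rewrite (@walk_step m setT (fun y => g (x +v y))).
- apply: eq_integral => w _; apply: eq_integral => y _.
  by rewrite addrA.
- exact: (walk_setT W).
- case: tg => mg _; apply: (measurableT_comp mg).
  exact: measurable_fun_addV.
- by move=> y; exact: test_fun_ge0.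
Qed.


(** The law of the walk at each time is a function of [mu] alone, which allows
    walks under different probabilities to be compared. *)
Lemma walk_law n (D : set borelV) : measurable D ->
  P (Y n @^-1` D) = iter n step (EFin \o \1_D) (0%R : V).
Proof.
move=> mD.
have tD : @test_fun R d (EFin \o \1_D).
  split=> [|x]; first exact/measurable_EFinP/measurable_indic.
  by rewrite /= indicE; case: (x \in D); rewrite !lee_fin lexx ler01.
have <- : jump setT n (EFin \o \1_D) = iter n step (EFin \o \1_D).
  elim: n => [|n ih]; first exact: jumpT0.
  by rewrite jumpTS// ih.
transitivity (\int[P]_w (\1_(Y n @^-1` D) w)%:E).
  by rewrite integral_indic ?setIT//; exact: measurable_walk_preimage.
rewrite /jump preimage_setT.
by apply: eq_integral => w _; rewrite /= add0r !indicE.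
Qed.

Variable H : set borelV.
Hypotheses (mH : measurable H) (H0 : ~ H (0%R : V)).
Hypothesis HD : forall x y, H x -> H y -> H (x +v y).
Hypothesis HCD : forall x y, (~` H) x -> (~` H) y -> (~` H) (x +v y).

Let mHC : measurable (~` H). Proof. exact: measurableC. Qed.

Definition avoid (G : set borelV) n : set T :=
  \bigcap_(i in [set i | (1 <= i <= n)%N]) (Y i @^-1` (~` G)).

Lemma avoid0 G : avoid G 0 = setT.
Proof. by apply/seteqP; split=> // w _ [|i] /andP[]. Qed.

Lemma avoidS G n : avoid G n.+1 = avoid G n `&` Y n.+1 @^-1` (~` G).
Proof.
apply/seteqP; split=> [w h|w [h hn] i /= /andP[i1]].
  split; last by apply: h; rewrite /= leqnn.
  by move=> i /= /andP[i1 iN]; apply: h => /=; rewrite i1 leqW.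
rewrite leq_eqVlt => /predU1P[->//|iN].
by apply: h => /=; rewrite i1.
Qed.

Lemma walk_avoid n : F n (avoid H n).
Proof.
elim: n => [|n ih]; first by rewrite avoid0; exact: (walk_setT W).
rewrite avoidS; apply: (walk_setI W).
  exact: (walk_mono W ih).
exact: (walk_adapted W).
Qed.

Lemma measurable_avoid n : measurable (avoid H n).
Proof. exact: (walk_measurable W (@walk_avoid n)). Qed.
Hint Resolve measurable_avoid : core.

Definition surv n (g : borelV -> \bar R) : \bar R :=
  \int[P]_(w in avoid H n) g (Y n w).

Definition enter n (g : borelV -> \bar R) : \bar R :=
  \int[P]_(w in avoid H n `&` Y n.+1 @^-1` H) g (Y n.+1 w).

(** At time [0] this uses that [H] does not contain the origin. *)
Lemma avoid_notin n w : avoid H n w -> ~ H (Y n w).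
Proof.
case: n => [_|n]; first by rewrite (walk_start W).
by rewrite avoidS => -[].
Qed.

Lemma measurable_test_walk n g D : test_fun g ->
  measurable_fun D (fun w => g (Y n w)).
Proof.
by case=> mg _; apply: measurable_funTS; exact: (measurableT_comp mg).
Qed.

(** One more step of the killed walk either stays out of [H] or enters it. *)
Lemma surv_step n g : test_fun g -> surv n (step g) = surv n.+1 g + enter n g.
Proof.
move=> tg; rewrite /surv -walk_step//; last 3 first.
- exact: walk_avoid.
- by case: tg.
- by move=> x; exact: test_fun_ge0.
rewrite avoidS /enter -ge0_integral_setU.
- by rewrite -setIUr -preimage_setU setUC setUCr preimage_setT setIT.
- by apply: measurableI => //; exact: measurable_walk_preimage.
- by apply: measurableI => //; exact: measurable_walk_preimage.
- exact: measurable_test_walk.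
- by move=> w _; exact: test_fun_ge0.
- apply/disj_set2P; rewrite setIACA -preimage_setI setICl.
  by rewrite preimage_set0 setI0.
Qed.

Lemma surv_fin n g : test_fun g -> surv n g \is a fin_num.
Proof.
move=> tg; rewrite ge0_fin_numE; last first.
  by apply: integral_ge0 => w _; exact: test_fun_ge0.
apply: (@le_lt_trans _ _ 1); last exact: ltry.
apply: (@le_trans _ _ (\int[P]_(w in avoid H n) 1)).
  apply: ge0_le_integral => //.
  - by move=> w _; exact: test_fun_ge0.
  - exact: measurable_test_walk.
  - by move=> w _; exact: test_fun_le1.
by rewrite integral_cst// mul1e; exact: probability_le1.
Qed.

Lemma enter_fin n g : test_fun g -> enter n g \is a fin_num.
Proof.
move=> tg; have := surv_fin n (test_step tg).
by rewrite surv_step// fin_numD => /andP[].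
Qed.

Lemma survD n g1 g2 : test_fun g1 -> test_fun g2 ->
  surv n (fun x => g1 x + g2 x) = surv n g1 + surv n g2.
Proof.
move=> t1 t2; rewrite /surv ge0_integralD//.
- by move=> w _; exact: test_fun_ge0.
- exact: measurable_test_walk.
- by move=> w _; exact: test_fun_ge0.
- exact: measurable_test_walk.
Qed.

Lemma test_cut (D : set borelV) g : measurable D -> test_fun g ->
  test_fun (g \_ D).
Proof.
move=> mD tg; split=> [|x].
  by apply/(measurable_restrictT _ mD); apply: measurable_funTS; case: tg.
rewrite patchE; case: ifPn => _; last by rewrite lexx lee01.
by case: tg.
Qed.



(** The instance of the abstract recursion for the walk.  That [H] and its
    complement are closed under addition is what makes a jump within [H] from a
    point of [H] stay in [H], and likewise for the complement. *)
Lemma enter_recursion n g : test_fun g ->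
  (n.+1%:R * fine (enter n g) +
     \sum_(k < n) fine (enter k (jump H (n - k) g)) =
   fine (jump H n.+1 g 0))%R.
Proof.
move=> tg; have c0 m g' : fine (surv 0 (jump H m g')) = fine (jump H m g' 0%R).
  rewrite /surv avoid0; under eq_integral do rewrite (walk_start W).
  rewrite integral_cst// -[in RHS](mule1 (jump H m g' 0%R)); congr (fine (_ * _)).
  exact: probability_setT.
rewrite -c0.
pose c n g := fine (surv n g); pose e n g := fine (enter n g).
have := @abstract_enter_recursion R _ (@test_fun R d) c e step (jump H)
  (jump (~` H)) (jump setT) (fun g => g \_ H) (fun g => g \_ (~` H)).
rewrite {}/c {}/e; apply.
- exact: test_step.
- by move=> m h; exact: test_jump.
- by move=> h; exact: test_cut.
- by move=> h; exact: test_cut.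
- by move=> k h th; rewrite surv_step// fineD//; [exact: surv_fin|exact: enter_fin].
- move=> k m h th; rewrite (jumpC mH)// survD; [|exact: test_jump..].
  by rewrite fineD//; apply: surv_fin; exact: test_jump.
- exact: jumpT0.
- by move=> m h th; rewrite jumpTS// jump_step.
- by move=> m h th; exact: jump_step.
- move=> k h; rewrite /surv integral0_eq// => w /avoid_notin Hw.
  by rewrite patchE memNset.
- move=> k h; congr fine; apply: eq_integral => w; rewrite inE => /avoid_notin Hw.
  by rewrite patchE mem_set.
- move=> k h; congr fine; apply: eq_integral => w; rewrite inE => -[_ /= Hw].
  by rewrite patchE mem_set.
- move=> k h; rewrite /enter integral0_eq// => w [_ /= Hw].
  by rewrite patchE memNset//= => /(_ Hw).
- move=> k m h; rewrite /surv integral0_eq// => w /avoid_notin Hw.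
  by apply: jump_eq0 => y; exact: HCD.
- move=> k m h; congr fine; apply: eq_integral => w; rewrite inE => /avoid_notin Hw.
  by apply: jump_id => y; exact: HCD.
- move=> k m h; congr fine; apply: eq_integral => w; rewrite inE => -[_ /= Hw].
  by apply: jump_id => y; exact: HD.
- move=> k m h; rewrite /enter integral0_eq// => w [_ /= Hw].
  by apply: jump_eq0 => y Hy; apply; exact: HD.
- by move=> m h; rewrite !c0; congr fine; apply: jump_id => y; rewrite add0r.
- by move=> m h; rewrite c0 jump_eq0// => y Hy; rewrite add0r; apply.
- exact: tg.
Qed.

(** The recursion tested against the constant [1].  In terms of the first
    entrance time [tau], it says that the probability of [Y n in H] is that of
    [tau < n, Y n - Y tau in H] plus [n] times that of [tau = n]. *)
Lemma entrance_recursion n :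
  (n.+1%:R * fine (P (avoid H n `&` Y n.+1 @^-1` H)) +
     \sum_(k < n) fine (P (avoid H k `&` Y k.+1 @^-1` H)) *
                  fine (P (Y (n - k)%N @^-1` H)) =
   fine (P (Y n.+1 @^-1` H)))%R.
Proof.
have t1 : @test_fun R d (cst 1).
  by split=> [|x]; [exact: measurable_cst|rewrite /cst lee01 lexx].
have j1 m x : jump H m (cst 1) x = P (Y m @^-1` H).
  by rewrite /jump integral_cst ?mul1e//; exact: measurable_walk_preimage.
have ecst k (a : R) : enter k (cst a%:E) = a%:E * P (avoid H k `&` Y k.+1 @^-1` H).
  rewrite /enter integral_cst//; apply: measurableI => //.
  exact: measurable_walk_preimage.
have := enter_recursion n t1.
rewrite j1 (ecst n 1%R) mul1e => <-; congr (_ + _)%R; apply: eq_bigr => k _.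
have -> : jump H (n - k) (cst 1) = cst (fine (P (Y (n - k)%N @^-1` H)))%:E.
  apply/funext => x; rewrite j1 /= fineK//.
  by apply: fin_num_measure; exact: measurable_walk_preimage.
have fe : P (avoid H k `&` Y k.+1 @^-1` H) \is a fin_num.
  apply: fin_num_measure; apply: measurableI => //.
  exact: measurable_walk_preimage.
by rewrite ecst -(fineK fe) -EFinM mulrC.
Qed.

End RandomWalk.

(** * From the recursion to the exponential formula *)

(** In this section [f n] is the probability of a first entrance at time
    [n + 1], whereas [a n] is attached to time [n]. *)
Section EntranceSeries.
Context (R : realType) (f a : nat -> R).
Hypotheses (f01 : forall n, 0 <= f n <= 1) (a01 : forall n, 0 <= a n <= 1).
Hypothesis fa : forall n,
  n.+1%:R * f n + \sum_(k < n) f k * a (n - k)%N = a n.+1.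

Let p N : {poly R} := \poly_(i < N.+1) (if i is k.+1 then - f k else 1).
Let q N : {poly R} := \poly_(i < N.+1) (if i is k.+1 then a k.+1 / k.+1%:R else 0).
(** [defect N * exp (q N)] is the derivative of [p N * exp (q N)]; it would
    vanish without the truncation. *)
Let defect N : {poly R} := (p N)^`() + p N * (q N)^`().

Let coef_dq N i : (i < N)%N -> (q N)^`()`_i = a i.+1.
Proof.
by move=> iN; rewrite coef_deriv coef_poly ltnS iN /= -[LHS]mulr_natr divfK ?pnatr_eq0.
Qed.

Let coef_dq_le N i : `|(q N)^`()`_i| <= 1.
Proof.
have [iN|iN] := ltnP i N.
  by rewrite coef_dq//; have /andP[? ?] := a01 i.+1; rewrite ger0_norm.
by rewrite coef_deriv coef_poly ltnS ltnNge iN mul0rn normr0.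
Qed.

Let coef_p_le N i : `|(p N)`_i| <= 1.
Proof.
rewrite coef_poly; case: ifPn => _; last by rewrite normr0.
by case: i => [|i]; rewrite ?normr1// normrN; have /andP[? ?] := f01 i; rewrite ger0_norm.
Qed.

(** Below the truncation order, the coefficients of the defect are exactly the
    instances of the recursion. *)
Let coef_defect_lt N i : (i < N)%N -> (defect N)`_i = 0.
Proof.
move=> iN; rewrite coefD coef_deriv coefM [(p N)`_i.+1]coef_poly ltnS iN.
rewrite big_ord_recl/= [(p N)`_0]coef_poly/= mul1r subn0 coef_dq// -fa.
rewrite [X in _ + (_ + X)](eq_bigr (fun k : 'I_i => - (f k * a (i - k)%N))).
  by rewrite sumrN addrK mulr_natl mulNrn addNr.
move=> k _; rewrite coef_poly /bump/= add1n ltnS.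
have ki : (k < i)%N by [].
rewrite (ltn_trans ki iN) coef_dq; last first.
  by rewrite (leq_ltn_trans _ iN)// leq_subr.
by rewrite subnSK// mulNr.
Qed.

Let coef_defect_ge N i : (N <= i)%N -> `|(defect N)`_i| <= i.+1%:R.
Proof.
move=> Ni; rewrite coefD coef_deriv [(p N)`_i.+1]coef_poly ltnS ltnNge Ni/=.
rewrite mul0rn add0r coefM (le_trans (ler_norm_sum _ _ _))//.
rewrite -[leRHS]mulr1 -[i.+1 in leRHS]card_ord -sum1_card natr_sum mulr_suml.
apply: ler_sum => j _; rewrite mul1r normrM -[leRHS]mulr1.
by apply: ler_pM.
Qed.

Let size_defect N : (size (defect N) <= N.+1.*2)%N.
Proof.
have sp : (size (p N) <= N.+1)%N by exact: size_poly.
have sq : (size (q N) <= N.+1)%N by exact: size_poly.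
rewrite (leq_trans (size_polyD _ _))// geq_max; apply/andP; split.
  rewrite (leq_trans (size_poly _ _))//; lia.
rewrite (leq_trans (size_polyMleq _ _))//.
have dq : (size (q N)^`() <= (size (q N)).-1)%N by exact: size_poly.
lia.
Qed.

Let defect_le N (z x : R) : 0 <= x <= z -> z <= 1 ->
  `|(defect N).[x]| <= (2 * N.+1%:R) ^+ 2 * z ^+ N.
Proof.
move=> /andP[x0 xz] z1; have z0 := le_trans x0 xz.
rewrite (horner_coef_wide _ (size_defect N)) (le_trans (ler_norm_sum _ _ _))//.
have -> : (2 * N.+1%:R) ^+ 2 * z ^+ N =
    \sum_(i < N.+1.*2) 2 * N.+1%:R * z ^+ N.
  rewrite sumr_const card_ord -[RHS]mulr_natl -muln2. rewrite natrM; ring.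
apply: ler_sum => i _; rewrite normrM (ger0_norm (exprn_ge0 _ x0)).
have [iN|iN] := ltnP i N.
  by rewrite coef_defect_lt// normr0 mul0r !mulr_ge0// exprn_ge0.
apply: ler_pM => //; first exact: exprn_ge0.
  rewrite (le_trans (coef_defect_ge iN))// -natrM ler_nat mul2n; exact: ltn_ord.
rewrite (@le_trans _ _ (z ^+ i))//; first by rewrite lerXn2r.
by rewrite ler_wiXn2l.
Qed.

Let q_le N (z x : R) : 0 <= x <= z -> z < 1 -> (q N).[x] <= (1 - z)^-1.
Proof.
move=> /andP[x0 xz] z1; have z0 := le_trans x0 xz.
rewrite (horner_coef_wide _ (size_poly _ _)).
apply: (@le_trans _ _ (\sum_(i < N.+1) z ^+ i)).
  apply: ler_sum => i _; rewrite coef_poly ltn_ord.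
  apply: (@le_trans _ _ (x ^+ i)); last by rewrite lerXn2r.
  rewrite -[leRHS]mul1r ler_wpM2r ?exprn_ge0//.
  case: (nat_of_ord i) => [|k]//.
  have /andP[? ak] := a01 k.+1.
  by rewrite ler_pdivrMr// mul1r (le_trans ak)// ler1n.
rewrite -[leRHS]mul1r ler_pdivlMr ?subr_gt0//.
rewrite -opprB mulrN mulrC -subrX1 opprB gerBl.
exact: exprn_ge0.
Qed.

(** Mean value inequality on [[0, z]] for a function with value [1] at [0]. *)
Let dist_le N (z : R) : 0 <= z < 1 ->
  `|(p N).[z] * expR (q N).[z] - 1| <=
  expR (1 - z)^-1 * ((2 * N.+1%:R) ^+ 2 * z ^+ N).
Proof.
move=> /andP[z0 z1].
pose h x := (p N).[x] * expR (q N).[x].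
pose dh x := (defect N).[x] * expR (q N).[x].
have dhE (x : R) : is_derive x 1 h (dh x).
  have dp := is_derive_poly (p N) x.
  have dq := is_derive_poly (q N) x.
  have de : is_derive x (1 : R) (expR \o horner (q N)) (expR (q N).[x] * (q N)^`().[x]).
    exact: is_derive1_comp.
  apply: (trigger_derive (is_deriveM dp de)).
  by rewrite /dh /defect hornerD hornerM /GRing.scale/=; ring.
have h0 : h 0 = 1.
  by rewrite /h !horner_coef0 !coef_poly/= expR0 mulr1.
have hc : {within `[0, z], continuous h}.
  apply: continuous_subspaceT => x.
  by apply/differentiable_continuous/derivable1_diffP; case: (dhE x).
have [c] := @MVT_segment R h dh 0 z z0 (fun x _ => dhE x) hc.
rewrite in_itv /= h0 subr0 -/(h z) => cz ->.
rewrite /dh !normrM (ger0_norm z0) (gtr0_norm (expR_gt0 _)).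
have cz' := cz; case/andP: cz' => c0 _.
apply: (@le_trans _ _ (`|(defect N).[c]| * expR (q N).[c])).
  by rewrite ler_piMr ?(ltW z1)// mulr_ge0// expR_ge0.
rewrite mulrC ler_pM ?expR_ge0//.
  by rewrite ler_expR; exact: q_le cz z1.
by apply: defect_le => //; exact: ltW.
Qed.


Let pE N (z : R) : (p N).[z] = 1 - \sum_(0 <= k < N) f k * z ^+ k.+1.
Proof.
rewrite (horner_coef_wide _ (size_poly _ _)) big_ord_recl coef_poly/= mulr1.
rewrite big_mkord -sumrN; congr (_ + _); apply: eq_bigr => k _.
by rewrite coef_poly /bump/= add1n ltnS ltn_ord mulNr.
Qed.

Let qE N (z : R) :
  (q N).[z] = \sum_(0 <= k < N) a k.+1 / k.+1%:R * z ^+ k.+1.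
Proof.
rewrite (horner_coef_wide _ (size_poly _ _)) big_ord_recl coef_poly/= mul0r add0r.
rewrite big_mkord; apply: eq_bigr => k _.
by rewrite coef_poly /bump/= add1n ltnS ltn_ord.
Qed.

(** The error bound is a constant times [(N + 1) ^ 2 * z ^ N].  It tends to [0]
    because, with [u] the fourth root of [z], [(N + 1) * u ^ N] is at most the
    sum of the geometric series of ratio [u], and two factors [u ^ N] absorb the
    square while the other two provide the decay. *)
Lemma entrance_partial_sums (z : R) : 0 <= z < 1 ->
  (1 - \sum_(0 <= k < N) f k * z ^+ k.+1) *
  expR (\sum_(0 <= k < N) a k.+1 / k.+1%:R * z ^+ k.+1) @[N --> \oo] --> (1 : R).
Proof.
move=> z01; have /andP[z0 z1] := z01.
under eq_fun do rewrite -pE -qE.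
pose u := Num.sqrt (Num.sqrt z).
have u0 : 0 <= u by exact: sqrtr_ge0.
have u4 : u ^+ 4 = z by rewrite (exprM u 2 2) !sqr_sqrtr// sqrtr_ge0.
have u1 : u < 1 by rewrite -(@ltr_pXn2r _ 4)// ?nnegrE// u4 expr1n.
have nu N : N.+1%:R * u ^+ N <= (1 - u)^-1.
  rewrite -[leRHS]mul1r ler_pdivlMr ?subr_gt0//.
  apply: (@le_trans _ _ ((\sum_(i < N.+1) u ^+ i) * (1 - u))).
    rewrite ler_wpM2r ?subr_ge0 ?(ltW u1)// mulr_natl -[N.+1 in leLHS]card_ord.
    rewrite -sumr_const; apply: ler_sum => i _.
    by rewrite ler_wiXn2l ?(ltW u1)// -ltnS.
  rewrite -opprB mulrN mulrC -subrX1 opprB gerBl.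
  exact: exprn_ge0.
pose C := expR (1 - z)^-1 * 4 * (1 - u)^-1 ^+ 2.
have C0 : 0 <= C.
  apply: mulr_ge0; first by rewrite mulr_ge0 ?expR_ge0.
  by apply: exprn_ge0; rewrite invr_ge0 subr_ge0 ltW.
have dist N : `|(p N).[z] * expR (q N).[z] - 1| <= C * (u ^+ 2) ^+ N.
  apply: (le_trans (dist_le N z01)).
  have -> : C * (u ^+ 2) ^+ N =
      expR (1 - z)^-1 * (4 * ((1 - u)^-1 ^+ 2 * (u ^+ 2) ^+ N)).
    by rewrite /C !mulrA.
  have -> : (2 * N.+1%:R) ^+ 2 * z ^+ N =
      4 * ((N.+1%:R * u ^+ N) ^+ 2 * (u ^+ 2) ^+ N).
    rewrite -u4 -!exprM (mulnC 4) (mulnC 2) (exprM u N 4) (exprM u N 2); ring.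
  rewrite ler_wpM2l ?expR_ge0// ler_wpM2l// ler_wpM2r ?exprn_ge0//.
  by rewrite lerXn2r ?nnegrE ?mulr_ge0 ?exprn_ge0 ?invr_ge0 ?subr_ge0 ?(ltW u1).
apply/cvgrPdist_le => e e0.
have : C * (u ^+ 2) ^+ N @[N --> \oo] --> (C * 0 : R).
  apply: cvgMr; apply: cvg_expr.
  by rewrite ger0_norm ?exprn_ge0// expr_lt1.
rewrite mulr0 => /cvgrPdist_le/(_ e e0); apply: filterS => N.
rewrite sub0r normrN ger0_norm; last by apply: mulr_ge0 => //; rewrite !exprn_ge0.
by rewrite distrC; exact: le_trans.
Qed.

End EntranceSeries.

Lemma cvg_fine_nneseries (R : realType) (v : nat -> R) (z : R) :
  0 <= z < 1 -> (forall n, 0 <= v n <= z ^+ n) ->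
  \sum_(0 <= k < N) v k.+1 @[N --> \oo] -->
  fine (\sum_(1 <= n <oo) (v n)%:E)%E.
Proof.
move=> /andP[z0 z1] vz.
pose S N := \sum_(1 <= k < N) v k.
have ndS : nondecreasing_seq S.
  apply/nondecreasing_seqP => -[|N]; first by rewrite /S !big_geq.
  by rewrite /S [leRHS]big_nat_recr//= lerDl; have /andP[] := vz N.+1.
have bS N : S N <= (1 - z)^-1.
  apply: (@le_trans _ _ (\sum_(i < N) z ^+ i)).
    rewrite -(big_mkord xpredT (fun i => z ^+ i)) /S.
    case: N => [|N]; first by rewrite !big_geq.
    rewrite [leRHS]big_nat_recl// -[leLHS]add0r lerD// big_add1/=.
    by apply: ler_sum => i _; have /andP[] := vz i.+1.
  rewrite -[leRHS]mul1r ler_pdivlMr ?subr_gt0//.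
  rewrite -opprB mulrN mulrC -subrX1 opprB gerBl.
  exact: exprn_ge0.
have cS : cvgn S.
  apply: nondecreasing_is_cvgn => //.
  by exists (1 - z)^-1 => _ [N _ <-]; exact: bS.
rewrite (_ : (\sum_(1 <= n <oo) (v n)%:E)%E = (limn S)%:E)/=; last first.
  apply/cvg_lim => //; under eq_fun do rewrite sumEFin.
  by apply: cvg_EFin; [exact: nearW|exact: cS].
have : S N.+1 @[N --> \oo] --> limn S by rewrite cvg_shiftS.
by apply: cvg_trans; apply: near_eq_cvg; apply: nearW => N; rewrite /S big_add1.
Qed.

Section Spitzer.
Context (R : realType) (d : nat) (disp : measure_display).
Context (T : measurableType disp).
Local Notation V := 'rV[R]_d.
Local Notation borelV := (borelRV R d).
Local Notation "x +v y" := ((x : V) + (y : V) : borelV)%R (at level 50).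
Variables (P : probability T R) (F : nat -> set (set T)).
Variables (mu : probability borelV R) (Y : nat -> T -> borelV).
Hypothesis W : random_walk P F mu Y.
Variable H : set borelV.
Hypotheses (mH : measurable H) (H0 : ~ H (0%R : V)).
Hypothesis HD : forall x y, H x -> H y -> H (x +v y).
Hypothesis HCD : forall x y, (~` H) x -> (~` H) y -> (~` H) (x +v y).

(** The partial sums on both sides converge by comparison with a geometric
    series, and the product of the limits is [1] by [entrance_partial_sums]. *)
Lemma spitzer_identity (z : R) : 0 < z < 1 ->
  1 - fine (\sum_(1 <= n <oo)
     (z ^+ n)%:E * P (avoid Y H n.-1 `&` Y n @^-1` H))%E =
  expR (- fine (\sum_(1 <= n <oo) (z ^+ n / n%:R)%:E * P (Y n @^-1` H))%E).
Proof.
move=> /andP[z0 z1].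
have z01 : 0 <= z < 1 by rewrite ltW.
have mY n : measurable (Y n @^-1` H) := measurable_walk_preimage W n mH.
have mE n k : measurable (avoid Y H n `&` Y k @^-1` H).
  by apply: measurableI => //; exact: (measurable_avoid W mH).
have prob01 (B : set T) : measurable B -> 0 <= fine (P B) <= 1.
  move=> mB; apply/andP; split; first exact: fine_ge0.
  have fB : P B \is a fin_num by exact: fin_num_measure.
  by rewrite -lee_fin fineK// probability_le1.
pose f n := fine (P (avoid Y H n `&` Y n.+1 @^-1` H)).
pose a n := fine (P (Y n @^-1` H)).
have f01 n : 0 <= f n <= 1 by exact: prob01.
have a01 n : 0 <= a n <= 1 by exact: prob01.
have fa n : n.+1%:R * f n + \sum_(k < n) f k * a (n - k)%N = a n.+1.
  exact: (entrance_recursion W mH H0 HD HCD).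
have cvg1 : \sum_(0 <= k < N) f k * z ^+ k.+1 @[N --> \oo] --> fine
    (\sum_(1 <= n <oo) (z ^+ n)%:E * P (avoid Y H n.-1 `&` Y n @^-1` H))%E.
  have bnd n : 0 <= z ^+ n * fine (P (avoid Y H n.-1 `&` Y n @^-1` H)) <= z ^+ n.
    have /andP[p0 p1] := prob01 _ (mE n.-1 n).
    by rewrite mulr_ge0 ?exprn_ge0 ?(ltW z0)//= ler_piMr// exprn_ge0// ltW.
  have := cvg_fine_nneseries z01 bnd.
  under eq_eseriesr do rewrite EFinM fineK ?fin_num_measure//.
  apply: cvg_trans; apply: near_eq_cvg; apply: nearW => N.
  by apply: eq_bigr => k _; rewrite /f mulrC.
have cvg2 : \sum_(0 <= k < N) a k.+1 / k.+1%:R * z ^+ k.+1 @[N --> \oo] --> fine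
    (\sum_(1 <= n <oo) (z ^+ n / n%:R)%:E * P (Y n @^-1` H))%E.
  have bnd n : 0 <= z ^+ n / n%:R * fine (P (Y n @^-1` H)) <= z ^+ n.
    have /andP[p0 p1] := prob01 _ (mY n).
    have zn : 0 <= z ^+ n by rewrite exprn_ge0// ltW.
    rewrite !mulr_ge0//= -mulrA ler_piMr// mulr_ile1//.
    by case: n {p0 p1 zn} => [|n]; rewrite ?invr0// invf_le1// ler1n.
  have := cvg_fine_nneseries z01 bnd.
  under eq_eseriesr do rewrite EFinM fineK ?fin_num_measure//.
  apply: cvg_trans; apply: near_eq_cvg; apply: nearW => N.
  by apply: eq_bigr => k _; rewrite /a mulrC mulrCA mulrC.
have := entrance_partial_sums f01 a01 fa z01.
set L1 := fine _ in cvg1 *; set L2 := fine _ in cvg2 * => lim1.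
have lim2 : (1 - \sum_(0 <= k < N) f k * z ^+ k.+1) *
  expR (\sum_(0 <= k < N) a k.+1 / k.+1%:R * z ^+ k.+1) @[N --> \oo] -->
  (1 - L1) * expR L2.
  apply: cvgM; first by apply: cvgB => //; exact: cvg_cst.
  by apply: continuous_cvg => //; exact: continuous_expR.
have L12 : (1 - L1) * expR L2 = 1.
  exact: (norm_cvg_unique lim2 lim1).
by rewrite -[LHS](mulfK (lt0r_neq0 (expR_gt0 L2))) L12 div1r expRN.
Qed.

End Spitzer.

(** * Expected discount factors as first-entrance series *)

Section DiscountSeries.
Context (R : realType) (d : nat) (disp : measure_display).
Context (T : measurableType disp) (X : R -> T -> 'rV[R]_d) (r : R).
Context (G : set 'rV[R]_d) (t : R).

Lemma eseries_unique_term (u : nat -> \bar R) (m : nat) : (0 < m)%N ->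
  (forall n, (0 < n)%N -> n != m -> u n = 0%E) ->
  (\sum_(1 <= n <oo) u n)%E = u m.
Proof.
move=> m0 u0; apply/cvg_lim => //; apply: cvg_near_cst.
exists m.+1 => // N /= mN.
rewrite (bigD1_seq m) ?iota_uniq ?mem_index_iota ?m0//=.
rewrite big_seq_cond big1 ?adde0// => n; rewrite mem_index_iota => /andP[/andP[n0 _]].
exact: u0.
Qed.

(** At most one term of the series is nonzero, the one indexed by the hitting
    time; none is when the set is never hit, in agreement with the discount
    factor [0] at infinity. *)
Lemma discount_hitting_time (w : T) :
  0 < r -> (discount r (hitting_time X G t w))%:E =
  (\sum_(1 <= n <oo) (expR (- (r * n%:R * t)))%:E *
                     (\1_(first_entry X G t n) w)%:E)%E.
Proof.
move=> r0; rewrite /hitting_time; case: pselect => [hit|nohit]; last first.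
  rewrite /discount mulry gtr0_sg// mul1e/=.
  rewrite (@eseries_unique_term _ 1)// => [|n n0 _].
    rewrite indicE memNset ?mule0// => -[_ Gw]; apply: nohit; exists 1%N.
    by rewrite /hits_at/=; exact/asboolP.
  rewrite indicE memNset ?mule0// => -[_ Gw]; apply: nohit; exists n.
  by rewrite /hits_at n0/=; exact/asboolP.
case: ex_minnP => m /andP[m0 /asboolP Gm] mmin.
rewrite (@eseries_unique_term _ m)//.
  rewrite indicE mem_set ?mule1.
    by rewrite /discount/= mulrA.
  split=> // i /= /andP[i0 im] Gi.
  have : (m <= i)%N by apply: mmin; rewrite /hits_at i0/=; exact/asboolP.
  by rewrite leqNgt -[m in (_ < m)%N](prednK m0) ltnS im.
move=> n n0 nm; rewrite indicE memNset ?mule0// => -[nG Gn].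
have mn : (m <= n)%N by apply: mmin; rewrite /hits_at n0/=; exact/asboolP.
apply: (nG m) => //=; rewrite m0/= -ltnS prednK//.
by rewrite ltn_neqAle eq_sym nm.
Qed.


Lemma discount_hitting_time_itv (w : T) : 0 < r -> 0 < t ->
  0 <= discount r (hitting_time X G t w) <= 1.
Proof.
move=> r0 t0; rewrite /hitting_time; case: pselect => [hit|nohit]; last first.
  by rewrite /discount mulry gtr0_sg// mul1e/= lexx ler01.
rewrite /discount/= expR_ge0/= -[leRHS]expR0 ler_expR oppr_le0.
by rewrite !mulr_ge0// ltW.
Qed.

Hypothesis mX : forall n : nat, measurable (X (n%:R * t) @^-1` G).

Lemma measurable_first_entry n : measurable (first_entry X G t n).
Proof.
apply: measurableI => //; apply: bigcap_measurableType => //.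
by move=> i _; rewrite preimage_setC; exact/measurableC/mX.
Qed.

Lemma measurable_discount : 0 < r ->
  measurable_fun setT (fun w => discount r (hitting_time X G t w)).
Proof.
move=> r0; apply/measurable_EFinP.
rewrite (_ : _ \o _ = fun w => \sum_(n <oo) if (1 <= n)%N then
    (expR (- (r * n%:R * t)))%:E * (\1_(first_entry X G t n) w)%:E else 0)%E;
  last by apply/funext => w /=; rewrite discount_hitting_time// eseries_cond eseries_mkcond.
apply: ge0_emeasurable_sum => [n w _ _|n _]; case: (1 <= n)%N => //=.
apply: measurable_funeM; apply/measurable_EFinP; apply: measurable_indic.
exact: measurable_first_entry.
Qed.

Lemma integral_discount (P : probability T R) : 0 < r ->
  (\int[P]_w (discount r (hitting_time X G t w))%:E =
  \sum_(1 <= n <oo) (expR (- (r * n%:R * t)))%:E * P (first_entry X G t n))%E.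
Proof.
move=> r0; under eq_integral do
  rewrite discount_hitting_time// eseries_cond eseries_mkcond.
rewrite integral_nneseries//; last 2 first.
- move=> n; case: (1 <= n)%N => //=.
  apply: measurable_funeM; apply/measurable_EFinP; apply: measurable_indic.
  exact: measurable_first_entry.
- by move=> n w _; case: (1 <= n)%N.
rewrite [RHS]eseries_cond [RHS]eseries_mkcond; apply: eq_eseriesr => n _.
case: (1 <= n)%N; last exact: integral0.
rewrite ge0_integralZl//.
- by rewrite integral_indic ?setIT//; exact: measurable_first_entry.
- apply/measurable_EFinP; apply: measurable_indic.
  exact: measurable_first_entry.

Qed.

Lemma integrable_discount (P : probability T R) : 0 < r -> 0 < t ->
  (fun w => discount r (hitting_time X G t w)) \in Lfun P 1.
Proof.
move=> r0 t0; apply/Lfun1_integrable.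
apply: measurable_bounded_integrable => //.
- exact: (le_lt_trans (probability_le1 _ _) (ltry _)).
- exact: measurable_discount.
- exists 1; split=> [|M M1 w _]; first exact: num_real.
  have /andP[? ?] := discount_hitting_time_itv w r0 t0.
  by rewrite /= ger0_norm// (le_trans _ (ltW M1)).
Qed.

End DiscountSeries.

Lemma discount_gapE (R : realType) (d : nat) (disp : measure_display)
    (T : measurableType disp) (X : R -> T -> 'rV[R]_d)
    (P : 'rV[R]_d -> probability T R) (r : R) (G : set 'rV[R]_d)
    (x : 'rV[R]_d) (s t : R) :
  0 < r -> 0 < s -> 0 < t ->
  (forall u, 0 <= u -> measurable (X u @^-1` G)) ->
  discount_gap X P r G s x t =
  first_entry_series X r (P x) G t - first_entry_series X r (P x) G s.
Proof.
move=> r0 s0 t0 mX.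
have mXt n : measurable (X (n%:R * t) @^-1` G).
  by apply: mX; rewrite mulr_ge0// ltW.
have mXs n : measurable (X (n%:R * s) @^-1` G).
  by apply: mX; rewrite mulr_ge0// ltW.
have Lt := integrable_discount mXt (P x) r0 t0.
have Ls := integrable_discount mXs (P x) r0 s0.
rewrite /discount_gap expectationB// fineB ?expectation_fin_num//.
by rewrite !unlock !integral_discount.
Qed.

(** * The centred grid walk of the basket *)

Section LevyWalk.
Context (R : realType) (d : nat) (disp : measure_display).
Context (T : measurableType disp).
Local Notation V := 'rV[R]_d.
Local Notation borelV := (borelRV R d).
Local Notation "x +v y" := ((x : V) + (y : V) : borelV)%R (at level 50).

Definition increment_law (p : R -> R.-pker borelRV R d ~> borelRV R d) (t : R) :
  set borelV -> \bar R := p t (0 : V).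

HB.instance Definition _ p t := Measure.on (increment_law p t).
HB.instance Definition _ p t := Measure_isProbability.Build _ _ _
  (increment_law p t) (@prob_kernel _ _ _ _ _ (p t) (0 : V)).

(** The value at time [0] is set to [0] outright, while [X 0 = x] holds only
    almost surely; this spares the exceptional event everywhere else. *)
Definition centred_walk (X : R -> T -> V) (x : V) (t : R) (n : nat) (w : T) :
  borelV := if n is 0 then 0 else X (n%:R * t) w - x.

Variables (F : R -> set (set T)) (X : R -> T -> V) (P : probability T R).
Variables (p : R -> R.-pker borelRV R d ~> borelRV R d) (x : V) (t : R).
Hypotheses (filtF : is_filtration F) (adX : is_adapted F X).
Hypothesis X0 : P (X 0 @^-1` [set x]) = 1%E.
Hypothesis invp : translation_invariant p.
Hypothesis markovX : is_markov F P p X.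
Hypothesis t0 : 0 < t.

Let nt0 n : 0 <= n%:R * t. Proof. by rewrite mulr_ge0// ltW. Qed.

Let sub_rV (y : V) : borelV -> borelV := fun z => z +v (- y).

Let measurable_sub_rV y : measurable_fun setT (sub_rV y).
Proof. exact: measurable_fun_addV. Qed.

Let FT u : 0 <= u -> F u setT.
Proof.
move=> u0; have [/(_ u u0)[F0 FC _] _ _] := filtF.
by rewrite -(setD0 setT); exact: FC.
Qed.

Let FI u : 0 <= u -> setI_closed (F u).
Proof.
by move=> u0; have [/(_ u u0)/sigma_algebraP[//|_ _ _]] := filtF.
Qed.

Let Fmeas u : 0 <= u -> F u `<=` measurable.
Proof. by move=> u0; have [_ + _] := filtF; exact. Qed.

Let adapted_shift u (B : set borelV) : 0 <= u -> measurable B ->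
  F u (X u @^-1` (sub_rV x @^-1` B)).
Proof.
move=> u0 mB; apply: adX => //; rewrite /borel_set.
by rewrite -[X in measurable X]setTI; exact: measurable_sub_rV.
Qed.

(** Translation invariance turns the transition probability from the current
    position into the increment law. *)
Let markov_shift n A (B : set borelV) : F (n%:R * t) A -> measurable B ->
  P (A `&` X (n.+1%:R * t) @^-1` (sub_rV x @^-1` B)) =
  (\int[P]_(w in A) increment_law p t
     [set y | B (sub_rV x (X (n%:R * t) w) +v y)])%E.
Proof.
move=> FA mB.
have mB' : measurable (sub_rV x @^-1` B).
  by rewrite -[X in measurable X]setTI; exact: measurable_sub_rV.
have mA := Fmeas (nt0 n) FA.
have [_ _ /(_ A FA)] := markovX (nt0 n) (ltW t0) mB'.
rewrite (_ : n%:R * t + t = n.+1%:R * t); last by rewrite -addn1 natrD mulrDl mul1r.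
rewrite [X in _ = X](_ : _ = P (A `&` X (n.+1%:R * t) @^-1` (sub_rV x @^-1` B))).
  move=> <-; apply: eq_integral => w _.
  rewrite fineK; last exact: finite_kernel_measure.
  have mC : measurable [set y : borelV | B (sub_rV x (X (n%:R * t) w) +v y)].
    rewrite -[X in measurable X]setTI.
    exact: measurable_fun_addV.
  rewrite /increment_law -(invp (ltW t0) (0 : V) (X (n%:R * t) w) mC) add0r; congr (p _ _ _).
  apply/seteqP; split=> [y /= By|_ [y /= By <-]].
    exists (y - X (n%:R * t) w); last by rewrite subrK.
    rewrite (_ : _ +v _ = sub_rV x y)//.
    by rewrite /sub_rV addrC addrA subrK.
  by rewrite (_ : sub_rV x _ = sub_rV x (X (n%:R * t) w) +v y)// /sub_rV (addrC y) addrAC.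
rewrite integral_indic//; first by rewrite setIC.
exact: (Fmeas (nt0 n.+1) (adapted_shift (nt0 n.+1) mB)).
Qed.

(** Only the first step differs from [markov_shift], and there the integrands
    agree on the almost sure event [X 0 = x]. *)
Lemma centred_walkP : random_walk P (fun n => F (n%:R * t)) (increment_law p t)
  (centred_walk X x t).
Proof.
split=> //.
- by move=> n; exact: FT.
- by move=> n; exact: FI.
- move=> n; have [_ _] := filtF; apply => //.
  by rewrite ler_pM2r// ler_nat.
- by move=> n; exact: Fmeas.
- case=> [|n] B mB; last exact: adapted_shift.
  have [B0|B0] := pselect (B (0 : V)).
    rewrite (_ : _ @^-1` _ = setT); first exact: FT.
    by apply/seteqP; split.
  rewrite (_ : _ @^-1` _ = set0); last by apply/seteqP; split=> // w /B0.
  by have [/(_ _ (nt0 0))[]] := filtF.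
case=> [|n] A B FA mB; last exact: markov_shift.
rewrite [LHS](markov_shift FA mB).
have mA := Fmeas (nt0 0) FA.
have mX : measurable_fun setT (X (0%:R * t) : T -> borelV).
  by move=> _ C mC; rewrite setTI; exact: (Fmeas (nt0 0) (adX (nt0 0) mC)).
have mE (Z : T -> borelV) : measurable_fun setT Z ->
    measurable_fun A (fun w => increment_law p t [set y | B (Z w +v y)]).
  move=> mZ; apply: measurable_funTS.
  have mZB : measurable ((fun z : T * borelV => Z z.1 +v z.2) @^-1` B).
    rewrite -[X in measurable X]setTI; apply: measurable_fun_addV => //.
    exact: measurableT_comp.
  rewrite (_ : (fun w => _) = increment_law p t \o
    xsection ((fun z : T * borelV => Z z.1 +v z.2) @^-1` B)).
    exact: measurable_fun_xsection.
  apply/funext => w /=; congr (increment_law p t _).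
  by apply/seteqP; split=> y; rewrite /xsection/= inE.
apply: ge0_ae_eq_integral => //.
- apply: (mE (fun w => sub_rV x (X (0%:R * t) w))).
  exact: (measurableT_comp (measurable_sub_rV x) mX).
- by apply: (mE (cst (0 : V))); exact: measurable_cst.
have mx : measurable (X 0 @^-1` [set x]).
  rewrite -(mul0r t) -[X in measurable X]setTI; apply: mX => //.
  rewrite -[X in measurable X]setCK; apply: measurableC.
  apply: measurable_open_rV; exact/closed_openC/accessible_closed_set1/hausdorff_accessible/norm_hausdorff.
exists (~` (X 0 @^-1` [set x])); split.
- exact: measurableC.
- transitivity (1 - P (X 0 @^-1` [set x]))%E; last by rewrite X0 subee.
  exact: probability_setC.
- move=> w /= nw Xw; apply: nw => _; rewrite mul0r /sub_rV Xw.
  by rewrite subrr.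
Qed.

End LevyWalk.

(** * The theorem *)

Section LevySpitzer.
Context (R : realType) (d : nat) (disp : measure_display).
Context (T : measurableType disp).
Local Notation V := 'rV[R]_d.
Local Notation borelV := (borelRV R d).
Variables (F : R -> set (set T)) (X : R -> T -> V) (P : V -> probability T R).
Variable r : R.
Hypothesis hX : is_levy_basket F X P r.
Variable H : set V.
Hypotheses (mH : borel_set H) (H0 : ~ H 0).
Hypotheses (cH : plus_closed H) (cHC : plus_closed (~` H)).

Lemma translate_preimage (x : V) (t : R) n (w : T) : (0 < n)%N ->
  [set x + h | h in H] (X (n%:R * t) w) <-> H (centred_walk X x t n w).
Proof.
case: n => // n _; rewrite /centred_walk; split=> [[h Hh <-]|Hw].
  by rewrite addrC addKr.
by exists (X (n.+1%:R * t) w - x) => //; rewrite addrC subrK.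
Qed.

Lemma first_entry_centred (x : V) (t : R) n : (0 < n)%N ->
  first_entry X [set x + h | h in H] t n =
  avoid (centred_walk X x t) H n.-1 `&` centred_walk X x t n @^-1` H.
Proof.
move=> n0; apply/seteqP; split=> w [a b]; split.
- move=> i /= /[dup] /andP[i0 _] ii; apply: contra_not (a i ii).
  exact: (translate_preimage _ _ _ i0).2.
- exact: (translate_preimage _ _ _ n0).1.
- move=> i /= /[dup] /andP[i0 _] ii; apply: contra_not (a i ii).
  exact: (translate_preimage _ _ _ i0).1.
- exact: (translate_preimage _ _ _ n0).2.
Qed.

(** The starting point appears on the left only: the law of the centred walk
    is the same under all the measures [P x], in particular under [P 0]. *)
Lemma first_entry_seriesE (x : V) (t : R) : 0 < t ->
  first_entry_series X r (P x) [set x + h | h in H] t =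
  1 - entry_exp_series X r (P 0) H t.
Proof.
move=> t0; have [filtF adX _ r0 [X0 [p [_ invp markovX]] _]] := hX.
have W y := centred_walkP filtF adX (X0 y) invp (markovX y) t0.
have HD (y z : V) : H y -> H z -> H (y + z).
  by move=> Hy Hz; apply: (cH.2); exists y => //; exists z.
have HCD (y z : V) : (~` H) y -> (~` H) z -> (~` H) (y + z).
  by move=> Hy Hz; apply: (cHC.2); exists y => //; exists z.
have z01 : 0 < expR (- (r * t)) < 1.
  by rewrite expR_gt0 -[ltRHS]expR0 ltr_expR oppr_lt0 mulr_gt0.
have zn n : expR (- (r * n%:R * t)) = expR (- (r * t)) ^+ n.
  by rewrite -expRM_natl; congr expR; ring.
have from1 (u v : nat -> \bar R) : (forall n, (0 < n)%N -> u n = v n) ->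
    (\sum_(1 <= n <oo) u n = \sum_(1 <= n <oo) v n)%E.
  by move=> uv; rewrite eseries_cond [RHS]eseries_cond; apply: eq_eseriesr => n /uv.
rewrite /first_entry_series /entry_exp_series.
rewrite (from1 _ (fun n => (expR (- (r * t)) ^+ n)%:E *
    P x (avoid (centred_walk X x t) H n.-1 `&` centred_walk X x t n @^-1` H))%E);
  last by move=> n n0; rewrite zn first_entry_centred.
rewrite [X in expR (- fine X)](from1 _ (fun n => (expR (- (r * t)) ^+ n / n%:R)%:E *
    P x (centred_walk X x t n @^-1` H))%E); last first.
  case=> // n _; rewrite zn (walk_law (W x))// -(walk_law (W 0))//.
  by rewrite /centred_walk/=; congr (_ * P 0 _)%E; apply/seteqP; split=> w /=; rewrite subr0.
by rewrite -(spitzer_identity (W x) mH H0 HD HCD z01) opprB addrC subrK.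
Qed.

End LevySpitzer.
Unset Implicit Arguments.
Set Strict Implicit.
Set Printing Implicit Defensive.

Theorem theorem3p2 (R : realType) (d : nat) (disp : measure_display)
    (T : measurableType disp) (F : R -> set (set T)) (X : R -> T -> 'rV[R]_d)
    (P : 'rV[R]_d -> probability T R) (r : R)
    (hX : is_levy_basket F X P r)
    (gamma : 'rV[R]_d) (H G : set 'rV[R]_d)
    (hG : G = [set gamma + h | h in H])
    (mH : borel_set H) (H0 : ~ H 0)
    (cH : plus_closed H) (cHC : plus_closed (~` H))
    (s : R) (hs : 0 < s)
    (hrho : rho_defined X P r G s gamma) :
  [/\ cvg (first_entry_series X r (P gamma) G t @[t --> 0^'+]),
      cvg (first_entry_series X r (P 0) H t @[t --> 0^'+]) &
      cvg (entry_exp_series X r (P 0) [set g - gamma | g in G] t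
             @[t --> 0^'+])] /\
  [/\ rho X P r G s gamma
      = eval_s_to_0 (first_entry_series X r (P gamma) G) s,
      eval_s_to_0 (first_entry_series X r (P gamma) G) s
      = eval_s_to_0 (first_entry_series X r (P 0) H) s &
      eval_s_to_0 (first_entry_series X r (P 0) H) s
      = eval_0_to_s (entry_exp_series X r (P 0) [set g - gamma | g in G]) s].
Proof.
have [filtF adX _ r0 _] := hX.
have GE : G = [set gamma + h | h in H] := hG.
have HE : H = [set 0 + h | h in H].
  apply/seteqP; split=> [h Hh|_ [h Hh <-]]; last by rewrite add0r.
  by exists h => //; rewrite add0r.
have GH : [set g - gamma | g in G] = H.
  rewrite hG; apply/seteqP; split=> [_ [_ [h Hh <-] <-]|h Hh].
    by rewrite addrC addKr.
  by exists (gamma + h); [exists h|rewrite addrC addKr].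
pose A := first_entry_series X r (P gamma) G.
pose B := first_entry_series X r (P 0) H.
pose E := entry_exp_series X r (P 0) H.
have AE t : 0 < t -> A t = 1 - E t.
  by move=> t0; rewrite /A GE (first_entry_seriesE hX mH H0 cH cHC).
have BE t : 0 < t -> B t = 1 - E t.
  by move=> t0; rewrite /B {1}HE (first_entry_seriesE hX mH H0 cH cHC).
have mXG u : 0 <= u -> measurable (X u @^-1` G).
  move=> u0; have [_ + _] := filtF; apply; first exact: u0.
  apply: adX => //; rewrite GE /borel_set (_ : image _ _ = (fun y => y - gamma) @^-1` H).
    rewrite -[X in measurable X]setTI.
    by apply: (@measurable_fun_addV _ _ _ _ id (cst (- gamma))).
  apply/seteqP; split=> [_ [h Hh <-]|y Hy]; first by rewrite /= addrC addKr.
  by exists (y - gamma) => //; rewrite addrC subrK.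
have gapE t : 0 < t -> discount_gap X P r G s gamma t = A t - A s.
  by move=> t0; rewrite discount_gapE.
have near0 (f g : R -> R) : (forall t, 0 < t -> f t = g t) ->
    \forall t \near 0^'+, f t = g t.
  by move=> fg; near=> t; apply: fg; near: t; exact: nbhs_right_gt.
pose l := lim (discount_gap X P r G s gamma t @[t --> 0^'+]).
have cgap : discount_gap X P r G s gamma t @[t --> 0^'+] --> l by exact: hrho.
have cA : A t @[t --> 0^'+] --> l + A s.
  have : discount_gap X P r G s gamma t + A s @[t --> 0^'+] --> l + A s.
    by apply: cvgD => //; exact: cvg_cst.
  apply: cvg_trans; apply: near_eq_cvg; apply: near0 => t t0.
  by rewrite gapE// subrK.
have cB : B t @[t --> 0^'+] --> l + A s.
  apply: cvg_trans cA; apply: near_eq_cvg; apply: near0 => t t0.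
  by rewrite AE// BE.
have cE : E t @[t --> 0^'+] --> 1 - (l + A s).
  have : 1 - A t @[t --> 0^'+] --> 1 - (l + A s).
    by apply: cvgB => //; exact: cvg_cst.
  apply: cvg_trans; apply: near_eq_cvg; apply: near0 => t t0.
  by rewrite AE// opprB addrC subrK.
rewrite GH; split.
  by split; [exact: cvgP cA|exact: cvgP cB|exact: cvgP cE].
rewrite /eval_s_to_0 /eval_0_to_s -/A -/B -/E.
rewrite (cvg_lim _ cA)// (cvg_lim _ cB)// (cvg_lim _ cE)//.
split; first by rewrite /rho -/l addrK.
- by rewrite AE// BE.
- rewrite BE// AE//; ring.
Unshelve. all: by end_near.
Qed.
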